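(* Let $r\ge 2$ and $2\le s\le t$ be integers, and let $H$ be a linear $r$-uniform hypergraph on $n$ vertices that is both $\mathcal{B}_r(K_{s,t})$-free and $\mathcal{B}_r(C_3)$-free. If $s=2$, then \[\rho(H)\le\frac{\sqrt{4(t-1)(n-1)+(r-t)^{2}}+r-t}{2(r-1)}.\] If $s\ge 3$, then \[\rho(H)\le \frac{(t-s+1)^{\frac{1}{s}}}{r-1}n^{1-\frac{1}{s}}+\frac{s-1}{r-1}n^{1-\frac{2}{s}}+s-2.\]
   Context: An $r$-uniform hypergraph has every edge an $r$-element subset of the vertex set; it is linear if any two distinct edges share at most one vertex. For a simple graph $F$, an $r$-uniform hypergraph $H$ is a Berge-$F$ if $V(F)\subseteq V(H)$ and there is a bijection $\phi:E(F)\to E(H)$ with $e\subseteq\phi(e)$ for each $e\in E(F)$; $\mathcal{B}_r(F)$ is the family of all $r$-uniform Berge-$F$ hypergraphs; $H$ is $\mathcal{B}_r(F)$-free if it contains no subhypergraph isomorphic to a member of $\mathcal{B}_r(F)$. $C_3$ is the triangle and $K_{s,t}$ the complete bipartite graph with parts of sizes $s$ and $t$. The adjacency tensor of $H$ on $\{v_1,\dots,v_n\}$ is $\mathcal{A}(H)=(a_{i_1\cdots i_r})$ with $a_{i_1\cdots i_r}=\frac{1}{(r-1)!}$ if $\{v_{i_1},\dots,v_{i_r}\}\in E(H)$ and $0$ otherwise; $\lambda$ is an eigenvalue if $\sum_{i_2,\dots,i_r}a_{ii_2\cdots i_r}x_{i_2}\cdots x_{i_r}=\lambda x_i^{r-1}$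 for all $i$ for some nonzero $\mathbf{x}\in\mathbb{C}^n$, and $\rho(H)$ is the maximum modulus of the eigenvalues of $\mathcal{A}(H)$. *)

(* Defs.v *)
From HB Require Import structures.
From mathcomp Require Import all_boot all_order all_algebra.
From mathcomp Require Import complex.
From mathcomp Require Import boolp classical_sets reals exp.

Set Implicit Arguments.
Unset Strict Implicit.
Unset Printing Implicit Defensive.

Import Order.TTheory GRing.Theory Num.Theory.

Local Open Scope ring_scope.

(* The vertex set of a hypergraph is the whole finite type V; a simple graph is
   a 2-uniform hypergraph. *)
Definition hypergraph (V : finType) := {set {set V}}.

Definition uniform (V : finType) (r : nat) (H : hypergraph V) : Prop :=
  forall e : {set V}, e \in H -> #|e| = r.

Definition linear_hypergraph (V : finType) (H : hypergraph V) : Prop :=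
  forall e f : {set V}, e \in H -> f \in H -> e != f -> (#|e :&: f| <= 1)%N.

Definition triangle : hypergraph 'I_3 := [set e : {set 'I_3} | #|e| == 2]%SET.

Definition complete_bipartite (s t : nat) : hypergraph ('I_s + 'I_t)%type :=
  [set [set inl i; inr j] | i in 'I_s, j in 'I_t]%SET.

(* H is, up to isomorphism, an r-uniform Berge-F: the inclusion V(F) <= V(H) is
   the injection f, and phi restricts to a bijection from E(F) onto E(H). *)
Definition is_berge (W V : finType) (r : nat) (F : hypergraph W)
    (H : hypergraph V) : Prop :=
  uniform r H /\
  exists (f : W -> V) (phi : {set W} -> {set V}),
    [/\ injective f,
        {in F &, injective phi},
        (phi @: F)%SET = H
      & forall e : {set W}, e \in F -> (f @: e)%SET \subset phi e].

(* Vertices of V lying in no edge of H' are harmless in is_berge, so it is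
   enough to consider the subhypergraphs H' of H with vertex set V. *)
Definition berge_free (W V : finType) (r : nat) (F : hypergraph W)
    (H : hypergraph V) : Prop :=
  forall H' : hypergraph V, H' \subset H -> ~ is_berge r F H'.

Section Tensor.
Variables (R : realType) (V : finType) (r : nat).

(* The tuple t is the multi-index (i_1, ..., i_r). *)
Definition adjacency_tensor (H : hypergraph V) (t : r.-tuple V) : R[i] :=
  if [set v in t]%SET \in H then ((r.-1)`!%:R)^-1 else 0.

(* The sum over i_2, ..., i_r is taken over the multi-indices t with i_1 = i,
   so that behead t = (i_2, ..., i_r). *)
Definition tensor_eigenvalue (A : r.-tuple V -> R[i]) (lambda : R[i]) : Prop :=
  exists2 x : {ffun V -> R[i]}, x != 0 &
    forall i : V,
      \sum_(t : r.-tuple V | ohead t == Some i) A t * \prod_(j <- behead t) x j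
      = lambda * x i ^+ r.-1.

(* The norm of R[i] takes values in R[i], hence the real part. *)
Definition eigenvalue_moduli (A : r.-tuple V -> R[i]) : set R :=
  [set complex.Re `|lambda| | lambda in [set l | tensor_eigenvalue A l]]%classic.

(* The maximum modulus: for r >= 2 and V nonempty, a tensor has finitely many
   eigenvalues and at least one, so this sup is attained. In any case the set
   of moduli is bounded (eigenvalue_moduli_ubound). *)
Definition spectral_radius (H : hypergraph V) : R :=
  sup (eigenvalue_moduli (adjacency_tensor H)).

Lemma eigenvalue_moduli_ubound (A : r.-tuple V -> R[i]) :
  has_ubound (eigenvalue_moduli A).
Proof.
exists (complex.Re (\sum_t `|A t|)) => _ [l [x x0 xE] <-].
suff : `|l| <= \sum_t `|A t| by rewrite lecE => /andP[].
have [k xk0] : exists k, x k != 0.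
  apply/existsP; apply: contraNT x0; rewrite negb_exists => /forallP x0.
  by apply/eqP/ffunP => k; rewrite ffunE; apply/eqP; rewrite -[_ == _]negbK.
have [i xi] : exists i, forall j, `|x j| <= `|x i|.
  have nR j : `|x j| \is Num.real by rewrite normr_real.
  suff /(_ (enum V))[i hi] : forall s : seq V, exists i, forall j, j \in s -> `|x j| <= `|x i|.
    by exists i => j; apply: hi; rewrite mem_enum.
  elim=> [|a s [i hi]]; first by exists k.
  have /orP[ai|ia] := real_leVge (nR a) (nR i).
    by exists i => j; rewrite inE => /predU1P[->//|/hi].
  exists a => j; rewrite inE => /predU1P[->//|/hi ji].
  exact: le_trans ia.
have xi0 : 0 < `|x i| ^+ r.-1.
  by rewrite exprn_gt0// (lt_le_trans _ (xi k))// normr_gt0.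
rewrite -(ler_pM2r xi0) -normrX -normrM -xE normrX.
apply: (le_trans (ler_norm_sum _ _ _)).
rewrite mulr_suml [leRHS](bigID (fun t : r.-tuple V => ohead t == Some i))/=.
rewrite -[leLHS]addr0 lerD//; last first.
  by apply: sumr_ge0 => t _; rewrite mulr_ge0// exprn_ge0.
apply: ler_sum => t _; rewrite normrM ler_wpM2l// normr_prod.
rewrite -[in leRHS](size_tuple t) -size_behead.
elim: (behead t) => [|a s IH]; first by rewrite big_nil.
by rewrite big_cons /= exprS ler_pM// prodr_ge0.
Qed.

End Tensor.

Arguments adjacency_tensor R {V} r H t.
Arguments spectral_radius R {V} r H.

(* Main.v *)
(* If the modulus vector [|x|] of an eigenvector is raised to the power [r - 1],
   AM-GM turns the eigenvalue equation of a linear hypergraph into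
   [(r - 1) |lambda| z <= A z], where A is the adjacency matrix of the shadow
   graph. A triangle of the shadow graph lies in one edge of H, and so does a
   K_{s,t}; hence, apart from paths inside one edge, which contribute
   [(r - 1) d(u)], the two-step paths from u are counted by the bipartite graph
   between N(u) and the non-neighbours of u, in which every s-subset of N(u) has
   at most [t - 2] common neighbours. Nikiforov's form of the Zarankiewicz bound
   gives row sums of [A^2] that are affine in [d(u)], and comparing z with the
   positive vector [deg + alpha], for a suitable constant [alpha], bounds
   [(r - 1) |lambda|]. *)
Require Import Defs.
From mathcomp Require Import all_boot all_order all_algebra.
From mathcomp Require Import ring lra zify.
From mathcomp Require Import complex.
From mathcomp Require Import reals exp.

Set Implicit Arguments.
Unset Strict Implicit.
Unset Printing Implicit Defensive.

Import Order.TTheory GRing.Theory Num.Theory.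

Local Open Scope ring_scope.

(** * The shadow graph *)

Lemma exists_subset_card (T : finType) (A : {set T}) (k : nat) :
  (k <= #|A|)%N -> exists2 B : {set T}, B \subset A & #|B| = k.
Proof.
rewrite -bin_gt0 -cards_draws => /card_gt0P[B].
by rewrite inE => /andP[BA /eqP Bk]; exists B.
Qed.

Section Shadow.
Variables (V : finType) (r : nat) (H : hypergraph V).

Definition shadow_adj : rel V :=
  fun u v => (u != v) && [exists e in H, (u \in e) && (v \in e)].

Definition shadow_nbhd (u : V) : {set V} := [set v | shadow_adj u v]%SET.

Lemma shadow_adj_sym : symmetric shadow_adj.
Proof.
move=> u v; rewrite /shadow_adj eq_sym; congr (_ && _).
by apply: eq_existsb => e; rewrite [(u \in e) && _]andbC.
Qed.

Lemma shadow_adjP (u v : V) :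
  reflect (u != v /\ exists e : {set V}, [/\ e \in H, u \in e & v \in e])
          (shadow_adj u v).
Proof.
apply: (iffP andP) => [[uv /exists_inP[e eH /andP[ue ve]]]|[uv [e [eH ue ve]]]].
  by split=> //; exists e.
by split=> //; apply/exists_inP; exists e => //; rewrite ue.
Qed.

Lemma in_shadow_nbhd (u v : V) : (v \in shadow_nbhd u) = shadow_adj u v.
Proof. by rewrite inE. Qed.

Hypothesis H_uniform : uniform r H.

(** Choose for every edge of [F] an edge of [H] that contains its image. An injective choice would
    make the chosen edges a Berge-[F], so two edges of [F] share their chosen edge. *)
Lemma berge_free_collision (W : finType) (F : hypergraph W) (f : W -> V) :
  berge_free r F H -> injective f ->
  (forall E : {set W}, E \in F ->
     exists2 e : {set V}, e \in H & (f @: E)%SET \subset e) ->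
  exists E E' : {set W}, exists e : {set V},
    [/\ E \in F, E' \in F & E != E'] /\
    [/\ e \in H, (f @: E)%SET \subset e & (f @: E')%SET \subset e].
Proof.
move=> Ffree f_inj Fcov.
pose phi (E : {set W}) : {set V} :=
  odflt set0%SET [pick e in H | (f @: E)%SET \subset e].
have phiP E : E \in F -> phi E \in H /\ (f @: E)%SET \subset phi E.
  rewrite /phi => /Fcov[e eH fe]; case: pickP => [e' /andP[]//|/(_ e)].
  by rewrite eH fe.
case: (boolP (dinjectiveb phi F)) => [/dinjectiveP phi_inj|].
  have sub : (phi @: F)%SET \subset H.
    by apply/subsetP => _ /imsetP[E EF ->]; case: (phiP E EF).
  case: (Ffree _ sub); split; first by move=> e /(subsetP sub); apply: H_uniform.
  exists f, phi; split=> // E EF; by case: (phiP E EF).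
move=> /dinjectivePn[E EF [E' /andP[E'E E'F] phiE]].
exists E, E', (phi E); split; split=> //; first by rewrite eq_sym.
- by case: (phiP E EF).
- by case: (phiP E EF).
- by rewrite phiE; case: (phiP E' E'F).
Qed.

Hypothesis H_linear : linear_hypergraph H.

Lemma linear_edge_eq (e f : {set V}) (u v : V) : e \in H -> f \in H -> u != v ->
  u \in e -> v \in e -> u \in f -> v \in f -> e = f.
Proof.
move=> eH fH uv ue ve uf vf; apply/eqP; apply: contraTT uv => ef.
have /card_le1_eqP := H_linear eH fH ef.
by move=> /(_ u v); rewrite !inE ue uf ve vf negbK => ->.
Qed.

Hypothesis H_C3_free : berge_free r triangle H.

Lemma shadow_triangle (x y z : V) :
  shadow_adj x y -> shadow_adj y z -> shadow_adj x z ->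
  exists2 e : {set V}, e \in H & [&& x \in e, y \in e & z \in e].
Proof.
move=> xy yz xz.
pose f (i : 'I_3) := tnth [tuple x; y; z] i.
have f_adj i j : i != j -> shadow_adj (f i) (f j).
  rewrite /f; case: i => [[|[|[|//]]] ?]; case: j => [[|[|[|//]]] ?];
    by rewrite //= ?/tnth //= => _; rewrite shadow_adj_sym.
have f_inj : injective f.
  move=> i j fij; apply/eqP; apply: contraT => /f_adj.
  by rewrite fij => /shadow_adjP[]; rewrite eqxx.
have cov (E : {set 'I_3}) : E \in triangle ->
    exists2 e : {set V}, e \in H & (f @: E)%SET \subset e.
  rewrite inE => /cards2P[i [j [ij ->]]].
  have /shadow_adjP[_ [e [eH ie je]]] := f_adj _ _ ij.
  exists e => //; apply/subsetP => _ /imsetP[k kij ->].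
  by move: kij; rewrite !inE => /orP[]/eqP->.
have [E [E' [e [[]]]]] := berge_free_collision H_C3_free f_inj cov.
rewrite !inE => /eqP E2 /eqP E'2 EE' [eH fE fE'].
(* Two distinct pairs in a three-point set cover it, so the shared edge contains the whole
   triangle. *)
have EUE' : (E :|: E')%SET = [set: 'I_3]%SET.
  apply/eqP; rewrite eqEcard subsetT cardsT card_ord.
  rewrite ltnNge; apply: contra EE' => UE.
  have /eqP -> : E == (E :|: E')%SET by rewrite eqEcard subsetUl E2.
  by rewrite eq_sym eqEcard subsetUr E'2.
have fe i : f i \in e.
  have : i \in (E :|: E')%SET by rewrite EUE' inE.
  rewrite inE => /orP[iE|iE'].
    by apply: (subsetP fE); apply: imset_f.
  by apply: (subsetP fE'); apply: imset_f.
by exists e; rewrite // (fe (@Ordinal 3 0 isT)) (fe (@Ordinal 3 1 isT))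
  (fe (@Ordinal 3 2 isT)).
Qed.

(** The triangle [u], [v], [w] lies in one edge, and by linearity that edge is [e], since both
    contain [u] and [v]. *)
Lemma shadow_adj_in_edge (e : {set V}) (u v w : V) : e \in H ->
  u \in e -> v \in e -> u != v -> shadow_adj u w -> shadow_adj v w -> w \in e.
Proof.
move=> eH ue ve uv uw vw.
have uv_adj : shadow_adj u v by apply/shadow_adjP; split=> //; exists e.
have [e' e'H /and3P[ue' ve' we']] := shadow_triangle uv_adj vw uw.
by rewrite (linear_edge_eq eH e'H uv).
Qed.

Lemma card_common_nbhd_adj (u v : V) : shadow_adj u v ->
  (#|shadow_nbhd u :&: shadow_nbhd v| <= r - 2)%N.
Proof.
move=> /shadow_adjP[uv [e [eH ue ve]]].
have -> : (r - 2 = #|e :\: [set u; v]|)%N.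
  rewrite cardsD (setIidPr _) ?cards2 ?uv ?(H_uniform eH)//.
  by apply/subsetP => w; rewrite !inE => /orP[]/eqP->.
apply/subset_leq_card/subsetP => w; rewrite !inE => /andP[uw vw].
rewrite (shadow_adj_in_edge eH ue ve) // negb_or !andbT.
by move: uw vw => /andP[uw _] /andP[vw _]; rewrite eq_sym uw eq_sym.
Qed.

(** A collision puts two edges of the complete bipartite graph, hence two vertices of one side, into
    a single edge [e]. These pull the other side into [e] by [shadow_adj_in_edge], and two vertices
    of that side then pull in the first. *)
Lemma shadow_Kst_in_edge (s t : nat) (A B : {set V}) :
  (2 <= s)%N -> (2 <= t)%N -> berge_free r (complete_bipartite s t) H ->
  #|A| = s -> #|B| = t ->
  {in A & B, forall a b, shadow_adj a b} ->
  exists2 e : {set V}, e \in H & A :|: B \subset e.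
Proof.
move=> s2 t2 Kfree As Bt AB.
have side (C D : {set V}) (c c' : V) (e : {set V}) :
    {in C & D, forall a b, shadow_adj a b} ->
    e \in H -> c \in C -> c' \in C -> c != c' -> c \in e -> c' \in e -> D \subset e.
  move=> CD eH cC c'C cc' ce c'e; apply/subsetP => d dD.
  by apply: (shadow_adj_in_edge eH ce c'e cc'); apply: CD.
have BA : {in B & A, forall b a, shadow_adj b a}.
  by move=> b a bB aA; rewrite shadow_adj_sym AB.
have sideU (C D : {set V}) (c c' : V) (e : {set V}) :
    {in C & D, forall a b, shadow_adj a b} ->
    {in D & C, forall a b, shadow_adj a b} -> (2 <= #|D|)%N ->
    e \in H -> c \in C -> c' \in C -> c != c' -> c \in e -> c' \in e ->
    (C \subset e) && (D \subset e).
  move=> CD DC D2 eH cC c'C cc' ce c'e.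
  have De := side C D c c' e CD eH cC c'C cc' ce c'e.
  have [d [d' [dD d'D dd']]] := card_gt1P D2.
  rewrite De andbT (side D C d d' e) //; exact: (subsetP De).
have sizeA : size (enum A) = s by rewrite -cardE.
have sizeB : size (enum B) = t by rewrite -cardE.
have [a0 a0A] : exists a, a \in A by apply/card_gt0P; rewrite As ltnW.
pose f (i : ('I_s + 'I_t)%type) := 
  match i with inl i => nth a0 (enum A) i | inr j => nth a0 (enum B) j end.
have fA i : f (inl i) \in A by rewrite -mem_enum mem_nth ?sizeA.
have fB j : f (inr j) \in B by rewrite -mem_enum mem_nth ?sizeB.
have adj_neq a b : shadow_adj a b -> a != b by case/shadow_adjP.
have f_inj : injective f.
  move=> [i|i] [j|j].
  - by move/eqP; rewrite /f nth_uniq ?sizeA ?enum_uniq // => /eqP/val_inj->.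
  - by move/eqP => fij; have /adj_neq := AB _ _ (fA i) (fB j); rewrite fij.
  - by move/eqP => fij; have /adj_neq := BA _ _ (fB i) (fA j); rewrite fij.
  - by move/eqP; rewrite /f nth_uniq ?sizeB ?enum_uniq // => /eqP/val_inj->.
have f_img (i : 'I_s) (j : 'I_t) (e : {set V}) :
    ((f @: [set inl i; inr j])%SET \subset e) = (f (inl i) \in e) && (f (inr j) \in e).
  by rewrite imsetU !imset_set1 subUset !sub1set.
have cov (E : {set 'I_s + 'I_t}) : E \in complete_bipartite s t ->
    exists2 e : {set V}, e \in H & (f @: E)%SET \subset e.
  move=> /imset2P[i j _ _ ->].
  have /shadow_adjP[_ [e [eH ie je]]] := AB _ _ (fA i) (fB j).
  by exists e => //; rewrite f_img ie.
have [E [E' [e [[]]]]] := berge_free_collision Kfree f_inj cov.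
move=> /imset2P[i j _ _ ->] /imset2P[i' j' _ _ ->] EE' [eH].
rewrite !f_img => /andP[ie je] /andP[i'e j'e].
exists e => //; rewrite subUset; have [ii'|ii'] := eqVneq i i'; last first.
  apply: (sideU A B (f (inl i)) (f (inl i'))); rewrite ?Bt //.
  by apply: contra ii' => /eqP/f_inj[->].
(* The colliding pairs differ, so if they agree on the side of [A] they differ on the side of [B],
   and the roles of the sides are exchanged. *)
have jj' : j != j' by apply: contra EE' => /eqP ->; rewrite ii'.
rewrite andbC; apply: (sideU B A (f (inr j)) (f (inr j'))); rewrite ?As //.
by apply: contra jj' => /eqP/f_inj[->].
Qed.

End Shadow.

(** * The Zarankiewicz bound *)

(** AM-GM for the numbers [x i ^+ size l]; both sides are compared after raising to the power
    [size l], which avoids roots. *)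
Lemma prod_le_mean_expr (R : realFieldType) (T : Type) (x : T -> R) (l : seq T) :
  (forall i, 0 <= x i) -> (0 < size l)%N ->
  (size l)%:R * \prod_(i <- l) x i <= \sum_(i <- l) x i ^+ size l.
Proof.
move=> x0 l0; set m := size l.
have m0 : 0 < m%:R :> R by rewrite ltr0n.
rewrite mulrC -ler_pdivlMr // (big_tnth _ _ l) (big_tnth _ _ l).
set S := \sum_(i < _) _.
have S0 : 0 <= S by apply: sumr_ge0 => i _; rewrite exprn_ge0.
rewrite -(@ler_pXn2r _ m) ?nnegrE ?divr_ge0 ?prodr_ge0 ?ler0n //.
have := (@leif_AGM R 'I_m predT (fun i => x (tnth (in_tuple l) i) ^+ m)).
rewrite /= card_ord prodrXl => /(_ _)[|//] => i _; exact: exprn_ge0.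
Qed.

(** AM-GM for one [b] and [m] copies of [y]: the power function lies above its tangent at [y]. *)
Lemma tangent_expr (R : realFieldType) (m : nat) (b y : R) : 0 <= b -> 0 <= y ->
  m.+1%:R * (b * y ^+ m) <= b ^+ m.+1 + m%:R * y ^+ m.+1.
Proof.
move=> b0 y0; have := @prod_le_mean_expr R _ (fun i : bool => if i then b else y)
  (true :: nseq m false).
rewrite /= size_nseq !big_cons !big_nseq iter_mulr_1 iter_addr_0 -[_ *+ m]mulr_natl.
by apply=> // -[].
Qed.

(** Cauchy-Schwarz against the constant 1, obtained by expanding a sum of squared deviations from
    the mean. *)
Lemma sqr_sum_le_card (R : realFieldType) (T : finType) (D : {set T}) (d : T -> R) :
  (\sum_(x in D) d x) ^+ 2 <= #|D|%:R * \sum_(x in D) d x ^+ 2.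
Proof.
set Z := \sum_(x in D) d x.
have [D0|D0] := posnP #|D|.
  by rewrite /Z (cards0_eq D0) !big_set0 mulr0 expr0n.
have {}D0 : 0 < #|D|%:R :> R by rewrite ltr0n.
have : 0 <= \sum_(x in D) (#|D|%:R * d x - Z) ^+ 2.
  by apply: sumr_ge0 => x _; rewrite sqr_ge0.
have -> : \sum_(x in D) (#|D|%:R * d x - Z) ^+ 2
  = #|D|%:R * (#|D|%:R * (\sum_(x in D) d x ^+ 2) - Z ^+ 2).
  transitivity (\sum_(x in D) (#|D|%:R ^+ 2 * d x ^+ 2 - 2 * #|D|%:R * Z * d x
                  + Z ^+ 2)).
    by apply: eq_bigr => x _; ring.
  rewrite !big_split /= sumr_const sumrN -!mulr_sumr -/Z -[_ *+ #|D|]mulr_natr.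
  by ring.
by rewrite pmulr_rge0 // subr_ge0.
Qed.

Lemma expn_subn_le_ffact (a m : nat) : ((a - m) ^ m.+1 <= a ^_ m.+1)%N.
Proof.
elim: m a => [|m IH] a; first by rewrite subn0 expn1 ffactn1.
case: a => [//|a]; rewrite ffactSS subSS expnS leq_mul //.
by rewrite ltnW // ltnS leq_subr.
Qed.

Lemma ffact_le_expn (a m : nat) : (a ^_ m <= a ^ m)%N.
Proof.
elim: m a => [|m IH] [|a] //; rewrite ffactSS expnS leq_mul //.
by apply: leq_trans (IH a) _; case: m {IH} => // m; rewrite leq_exp2r.
Qed.

(** Double counting of the pairs of a [w] in [W] and an [s]-subset of [D] inside [B w]. *)
Lemma sum_bin_neighbourhoods (U T : finType) (B : U -> {set T}) (W : {set U})
    (D : {set T}) (s c : nat) :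
  (forall S : {set T}, S \subset D -> #|S| = s ->
     (#|[set w in W | S \subset B w]| <= c)%N) ->
  (\sum_(w in W) 'C(#|D :&: B w|, s) <= c * 'C(#|D|, s))%N.
Proof.
move=> few.
under eq_bigr => w _ do rewrite -cards_draws -sum1_card.
rewrite (exchange_big_dep [pred S : {set T} | (S \subset D) && (#|S| == s)]) /=.
  rewrite -cards_draws -sum1_card big_distrr /=.
  under [leqRHS]eq_bigl => S do rewrite inE.
  apply: leq_sum => S /andP[SD /eqP Ss]; rewrite muln1.
  apply: leq_trans (few S SD Ss); rewrite sum1_card.
  apply/subset_leq_card/subsetP => w; rewrite unfold_in !inE => /andP[-> /andP[+ _]].
  by rewrite subsetI => /andP[].
by move=> w S _; rewrite inE subsetI => /andP[/andP[-> _] ->].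
Qed.

(** The classical convexity argument: the double count bounds the sum of the powers of the reduced
    degrees [b w], and the tangent inequality turns this into a bound on their sum. *)
Lemma zarankiewicz_sum_base (R : realFieldType) (U T : finType) (B : U -> {set T})
    (m c : nat) (q N : R) (W : {set U}) (D : {set T}) :
  0 < q -> 0 < N -> q ^+ m.+1 = c%:R -> #|W|%:R <= N ^+ m.+1 ->
  (forall S : {set T}, S \subset D -> #|S| = m.+1 ->
     (#|[set w in W | S \subset B w]| <= c)%N) ->
  \sum_(w in W) #|D :&: B w|%:R <= q * N ^+ m * #|D|%:R + m%:R * N ^+ m.+1.
Proof.
move=> q0 N0 qc WN /sum_bin_neighbourhoods few.
set d := #|D| in few *.
(* Lowering by [m] puts [b w ^ m.+1] below the falling factorial of the degree; restoring [m] for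
   every [w] costs the term [m%:R * N ^+ m.+1]. *)
pose b w := (#|D :&: B w| - m)%N.
have sum_b : (\sum_(w in W) b w ^ m.+1 <= c * d ^ m.+1)%N.
  have /leq_trans : (\sum_(w in W) b w ^ m.+1
      <= \sum_(w in W) #|D :&: B w| ^_ m.+1)%N.
    by apply: leq_sum => w _; exact: expn_subn_le_ffact.
  apply; under eq_bigr => w _ do rewrite -bin_ffact.
  rewrite -big_distrl /=; apply: leq_trans (_ : _ <= c * d ^_ m.+1)%N _.
    by rewrite -bin_ffact mulnA leq_mul2r few orbT.
  by rewrite leq_mul2l ffact_le_expn orbT.
have {}sum_b : \sum_(w in W) (b w)%:R ^+ m.+1 <= (q * d%:R) ^+ m.+1 :> R.
  rewrite exprMn qc -natrX -natrM (eq_bigr (fun w => (b w ^ m.+1)%:R)).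
    by rewrite -natr_sum ler_nat.
  by move=> w _; rewrite natrX.
apply: (@le_trans _ _ (\sum_(w in W) ((b w)%:R + m%:R))).
  by apply: ler_sum => w _; rewrite -natrD ler_nat /b; lia.
rewrite big_split /= sumr_const -[m%:R *+ _]mulr_natr lerD //; last first.
  by rewrite ler_wpM2l.
(* The point of tangency chosen below must be positive, so an empty [D] is settled first. *)
have [d0|d0] := posnP d.
  rewrite big1 ?d0 ?mulr0 // => w _; rewrite /b.
  have := subset_leq_card (subsetIl D (B w)); rewrite -/d d0 leqn0 => /eqP->.
  by rewrite sub0n.
have {}d0 : 0 < d%:R :> R by rewrite ltr0n.
(* [y] is the value of all [b w] in the extremal case of the power-mean inequality. *)
pose y := q * d%:R / N.
have y0 : 0 < y by rewrite divr_gt0 // mulr_gt0.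
have yN : q * d%:R = y * N by rewrite /y divfK ?gt_eqF.
have m0 : 0 < m.+1%:R :> R by rewrite ltr0n.
rewrite -(ler_pM2l m0) -(ler_pM2r (exprn_gt0 m y0)) -mulrA mulr_suml mulr_sumr.
apply: le_trans (ler_sum _ (fun w _ => tangent_expr m (ler0n R (b w)) (ltW y0))) _.
rewrite big_split /= sumr_const -[_ *+ #|W|]mulr_natr.
apply: (@le_trans _ _ ((y * N) ^+ m.+1 + m%:R * y ^+ m.+1 * N ^+ m.+1)).
  by rewrite lerD -?yN // ler_wpM2l // mulr_ge0 // exprn_ge0 // ltW.
rewrite (mulrAC q) yN le_eqVlt; apply/orP; left; apply/eqP.
by rewrite -[m.+1%:R]natr1 exprMn !exprS; ring.
Qed.

(* Nikiforov's induction: with [s = m + 1], [q = c^(1/s)] and [N = n^(1/s)]. The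
   induction hypothesis applies to [W] minus [w0] and the neighbours of [w0] in
   [D], where the number of allowed common neighbours drops by one; summing over
   [w0] bounds the sum of the squared degrees of the elements of [D]. *)
Lemma zarankiewicz_sum (R : realFieldType) (U T : finType) (B : U -> {set T})
    (m c k : nat) (q N : R) (W : {set U}) (D : {set T}) :
  1 <= q -> 1 <= N -> q ^+ m.+1 = c%:R -> #|W|%:R <= N ^+ m.+1 ->
  (forall S : {set T}, S \subset D -> #|S| = m.+1 ->
     (#|[set w in W | S \subset B w]| <= c + k)%N) ->
  \sum_(w in W) #|D :&: B w|%:R
    <= (q * N ^+ m + k%:R) * #|D|%:R + m%:R * N ^+ (m.+1 + k).
Proof.
move=> q1 N1 qc; have q0 := lt_le_trans ltr01 q1; have N0 := lt_le_trans ltr01 N1.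
elim: k W D => [|k IH] W D WN few.
  rewrite addr0 addn0; apply: (zarankiewicz_sum_base q0 N0 qc WN) => S SD Sm.
  by rewrite -[leqRHS]addn0 few.
pose d x : R := \sum_(w in W) (x \in B w)%:R.
have sum_indic (E A : {set T}) (g : T -> R) :
    \sum_(x in E) (x \in A)%:R * g x = \sum_(x in E :&: A) g x.
  rewrite (big_setID A) /= [X in _ + X]big1 ?addr0.
    by apply: eq_bigr => x; rewrite inE => /andP[_ ->]; rewrite mul1r.
  by move=> x; rewrite inE => /andP[/negbTE-> _]; rewrite mul0r.
have cardE (w : U) (E : {set T}) : #|E :&: B w|%:R = \sum_(x in E) (x \in B w)%:R :> R.
  by rewrite -sum1_card natr_sum -sum_indic; apply: eq_bigr => x _; rewrite mulr1.
set Z := \sum_(w in W) _.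
have Zd : Z = \sum_(x in D) d x.
  by rewrite /Z exchange_big /=; apply: eq_bigr => w _; rewrite cardE.
pose beta := q * N ^+ m + k.+1%:R; rewrite -/beta.
have step w0 : w0 \in W -> \sum_(w in W) #|(D :&: B w0) :&: B w|%:R
    <= beta * #|D :&: B w0|%:R + m%:R * N ^+ (m.+1 + k).
  (* The term [w = w0] is the full degree of [w0]; the step from [k] to [k.+1] in [beta] pays for
     it. *)
  move=> w0W; rewrite (big_setD1 w0) //= -setIA setIid.
  rewrite /beta -natr1 addrA mulrDl mul1r addrAC addrC lerD //.
  apply: IH => [|S]; first by apply: le_trans WN; rewrite ler_nat subset_leq_card ?subD1set.
  rewrite subsetI => /andP[SD Sw0] Sm.
  have := few S SD Sm; rewrite (cardsD1 w0) inE w0W Sw0 addnS add1n ltnS.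
  apply: leq_trans; apply/subset_leq_card/subsetP => w.
  by rewrite !inE => /andP[/andP[-> ->] ->].
have sum_sqr : \sum_(x in D) d x ^+ 2 <= beta * Z + m%:R * N ^+ (m.+1 + k) * N ^+ m.+1.
  have -> : \sum_(x in D) d x ^+ 2
      = \sum_(w0 in W) \sum_(w in W) #|(D :&: B w0) :&: B w|%:R.
    transitivity (\sum_(x in D) \sum_(w0 in W) \sum_(w in W)
        ((x \in B w0)%:R * (x \in B w)%:R : R)).
      apply: eq_bigr => x _; rewrite expr2 mulr_suml; apply: eq_bigr => w0 _.
      by rewrite mulr_sumr.
    rewrite exchange_big /=; apply: eq_bigr => w0 _.
    rewrite exchange_big /=; apply: eq_bigr => w _.
    by rewrite cardE sum_indic.
  apply: le_trans (ler_sum _ step) _.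
  rewrite big_split /= -mulr_sumr lerD // sumr_const -[_ *+ #|W|]mulr_natr ler_wpM2l //.
  by rewrite mulr_ge0 // exprn_ge0 // ltW.
have beta1 : N ^+ m <= beta.
  by rewrite /beta -[leLHS]addr0 lerD // ler_peMl // exprn_ge0 // ltW.
(* By Cauchy-Schwarz, [sum_sqr] bounds [Z * (Z - beta * #|D|)] by [#|D| * N ^+ m * eps], hence by
   [beta * #|D| * eps]. A [Z] above [beta * #|D| + eps] violates this quadratic inequality. *)
rewrite leNgt; apply/negP; set eps := m%:R * _ => Zgt.
have eps0 : 0 <= eps by rewrite mulr_ge0 // exprn_ge0 // ltW.
have D0 : 0 <= #|D|%:R :> R by [].
have beta0 : 0 <= beta by apply: le_trans beta1; rewrite exprn_ge0 // ltW.
have bD0 : 0 <= beta * #|D|%:R by rewrite mulr_ge0.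
have lower : (beta * #|D|%:R + eps) * eps < Z * (Z - beta * #|D|%:R).
  by apply: ltr_pM; rewrite ?addr_ge0 // ltrBrDl.
have upper : Z * (Z - beta * #|D|%:R)
    <= #|D|%:R * (m%:R * N ^+ (m.+1 + k) * N ^+ m.+1).
  have := sqr_sum_le_card D d; rewrite -Zd => /le_trans.
  by move=> /(_ _ (ler_wpM2l D0 sum_sqr)) ?; lra.
have : #|D|%:R * (m%:R * N ^+ (m.+1 + k) * N ^+ m.+1) <= beta * #|D|%:R * eps.
  rewrite [beta * _]mulrC -[leRHS]mulrA ler_wpM2l //.
  have -> : m%:R * N ^+ (m.+1 + k) * N ^+ m.+1 = N ^+ m * eps.
    by rewrite /eps addnS !exprS; ring.
  by rewrite ler_wpM2r.
have : 0 <= eps * eps by rewrite mulr_ge0.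
by move: lower upper; lra.
Qed.

(** * Eigenvalues and the shadow graph *)

(** By linearity [i] and [j] determine the edge [e], so such a tuple is [i] followed by one of the
    [m!] orderings of [e :\ i]. *)
Lemma card_tuples_through_adj (V : finType) (m : nat) (H : hypergraph V) (i j : V) :
  uniform m.+1 H -> linear_hypergraph H ->
  (#|[set t : m.+1.-tuple V | [&& ohead t == Some i,
        [set v in t]%SET \in H & j \in behead t]]| <= m`! * shadow_adj H i j)%N.
Proof.
move=> H_uniform H_linear; set S := [set t | _]%SET.
have SP (t : m.+1.-tuple V) : t \in S -> [/\ t = i :: behead t :> seq V, uniq t,
    [set v in t]%SET \in H & j \in behead t].
  rewrite inE => /and3P[ti tH jt]; split=> //.
    by move: ti; case: t {tH jt} => -[//|a s] /= _ /eqP[->].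
  (* Uniformity makes the entries distinct: their set has as many elements as the tuple has
     places. *)
  by apply/card_uniqP; rewrite size_tuple -[RHS](H_uniform _ tH) cardsE.
have SP' (t : m.+1.-tuple V) : t \in S ->
    [/\ i != j, i \in [set v in t]%SET & j \in [set v in t]%SET].
  move=> /SP[ti tu _ jt]; rewrite !inE (mem_behead jt).
  have it : i \in tval t by rewrite ti mem_head.
  split=> //; move: tu; rewrite ti /= => /andP[it' _].
  by apply: contraNneq it' => ->.
case: (boolP (shadow_adj H i j)) => [/shadow_adjP[ij [e [eH ie je]]]|nij]; last first.
  rewrite muln0 leqn0 cards_eq0; apply: contraNT nij => /set0Pn[t tS].
  apply/shadow_adjP; have [ij it jt] := SP' _ tS; split=> //.
  by exists [set v in t]%SET; have [_ _ tH _] := SP _ tS.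
rewrite muln1 -ffactnn.
have -> : (m ^_ m = #|e :\ i| ^_ m)%N.
  by rewrite (_ : #|e :\ i| = m) //; apply/succn_inj; rewrite -(H_uniform _ eH) (cardsD1 i e) ie.
rewrite -(card_uniq_tuples m [in e :\ i]).
have binj : {in S &, injective (fun t : m.+1.-tuple V => [tuple of behead t])}.
  move=> t t' /SP[ti _ _ _] /SP[t'i _ _ _] /(congr1 val) /= tt'.
  by apply: val_inj; rewrite /= ti t'i tt'.
rewrite -(card_in_imset binj); apply/subset_leq_card/subsetP => _ /imsetP[t tS ->].
have [ti tu tH jt] := SP _ tS; have [_ it jt'] := SP' _ tS.
have te : [set v in t]%SET = e by apply: (linear_edge_eq H_linear tH eH ij).
have /andP[it' tu'] : (i \notin behead t) && uniq (behead t).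
  by move: tu; rewrite {1}ti.
rewrite inE /= tu' andbT; apply/allP => v vt.
rewrite !inE -te inE (mem_behead vt) andbT.
by apply: contraNneq it' => <-.
Qed.

Section Spectral.
Variables (R : realType) (V : finType).

Definition cmod (c : R[i]) : R := complex.Re `|c|.

Lemma cmodE (c : R[i]) : `|c| = (cmod c)%:C%C.
Proof. by rewrite /cmod normc_def. Qed.

Lemma cmod_ge0 (c : R[i]) : 0 <= cmod c.
Proof. by rewrite -ler0c -cmodE. Qed.

Lemma spectral_radius_le (r : nat) (H : hypergraph V) (b : R) : 0 <= b ->
  (forall l : R[i], tensor_eigenvalue (adjacency_tensor R r H) l -> cmod l <= b) ->
  spectral_radius R r H <= b.
Proof.
move=> b0 lb; rewrite /spectral_radius.
have [[x Ex]|/classical_sets.nonemptyPn ->] :=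
    boolp.EM (classical_sets.nonempty (eigenvalue_moduli (adjacency_tensor R r H))).
  by apply: ge_sup; [exists x|move=> _ [l /lb lb' <-]].
(* Without eigenvalues the supremum is 0 by convention, which [0 <= b] covers. *)
by rewrite sup0.
Qed.

(* AM-GM bounds each product of [r - 1] moduli by the mean of their powers, and
   by linearity each neighbour of [i] occurs in exactly one edge at [i]. *)
Lemma tensor_eigenvalue_shadow (r : nat) (H : hypergraph V) (l : R[i]) :
  (2 <= r)%N -> uniform r H -> linear_hypergraph H ->
  tensor_eigenvalue (adjacency_tensor R r H) l ->
  exists z : V -> R, [/\ forall i, 0 <= z i, exists i, 0 < z i
    & forall i, r.-1%:R * cmod l * z i <= \sum_(j | shadow_adj H i j) z j].
Proof.
case: r => [//|[//|m]] _ H_uniform H_linear [x x0 xE].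
(* From here on [r] is one less than the size of an edge, the number written [r.-1] in the
   statement. *)
set r := m.+1; rewrite -/r in H_uniform xE *.
pose y i := cmod (x i); pose z i := y i ^+ r.
have y0 i : 0 <= y i by exact: cmod_ge0.
have z0 i : 0 <= z i by rewrite exprn_ge0.
exists z; split=> //.
  have [k xk0] : exists k, x k != 0.
    apply/existsP; apply: contraNT x0; rewrite negb_exists => /forallP x0.
    by apply/eqP/ffunP => k; rewrite ffunE; apply/eqP; rewrite -[_ == _]negbK.
  by exists k; rewrite exprn_gt0 // -(ltcR 0) -cmodE normr_gt0.
move=> i.
have A0 (t : r.+1.-tuple V) :
    `|adjacency_tensor R r.+1 H t| = (([set v in t]%SET \in H)%:R / r`!%:R : R)%:C%C.
  rewrite /adjacency_tensor; case: ifP => _; last by rewrite normr0 mul0r.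
  by rewrite mul1r normfV ger0_norm // rmorphV ?unitfE ?pnatr_eq0 -?lt0n ?fact_gt0 // rmorph_nat.
have le1 : cmod l * z i <= \sum_(t : r.+1.-tuple V | ohead t == Some i)
    ([set v in t]%SET \in H)%:R / r`!%:R * \prod_(j <- behead t) y j.
  rewrite -lecR rmorphM rmorphXn /= -!cmodE -normrX -normrM -xE.
  rewrite rmorph_sum; apply: le_trans (ler_norm_sum _ _ _) _.
  apply: ler_sum => t _; rewrite normrM A0 normr_prod [leRHS]rmorphM rmorph_prod /=.
  by under eq_bigr => j _ do rewrite cmodE.
have f0 : 0 < r`!%:R :> R by rewrite ltr0n fact_gt0.
rewrite -mulrA; apply: le_trans (ler_wpM2l (ler0n _ _) le1) _; rewrite mulr_sumr.
apply: (@le_trans _ _ (\sum_(t : r.+1.-tuple V | ohead t == Some i)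
    ([set v in t]%SET \in H)%:R / r`!%:R * \sum_(j | j \in behead t) z j)).
  apply: ler_sum => t ti; rewrite mulrCA.
  have [tH|_] := boolP (_ \in H); last by rewrite !mul0r.
  rewrite ler_wpM2l ?mul1r ?invr_ge0 ?(ltW f0) //.
  have tu : uniq (behead t).
    have : uniq t by apply/card_uniqP; rewrite size_tuple -[RHS](H_uniform _ tH) cardsE.
    by case: (val t) => //= a s /andP[].
  rewrite -big_uniq //.
  have st : size (behead t) = r by rewrite size_behead size_tuple.
  by have := @prod_le_mean_expr R V y (behead t) y0; rewrite st; apply.
under eq_bigr => t _ do rewrite mulr_sumr big_mkcond /=.
(* After the exchange, the coefficient of [z j] is the number of tuples at [i] through [j] divided
   by [r!], which is at most 1 for a neighbour [j] of [i] and 0 otherwise. *)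
rewrite exchange_big /= [leRHS]big_mkcond /=; apply: ler_sum => j _.
apply: (@le_trans _ _ (#|[set t : r.+1.-tuple V | [&& ohead t == Some i,
        [set v in t]%SET \in H & j \in behead t]]|%:R / r`!%:R * z j)).
  rewrite -sum1_card natr_sum 2!mulr_suml big_mkcond [leRHS]big_mkcond /=.
  apply: ler_sum => t _; rewrite inE.
  by case: (ohead t == _); case: (_ \in H); case: (j \in _); rewrite //= ?mul0r.
have -> : (if shadow_adj H i j then z j else 0) = (shadow_adj H i j)%:R * z j.
  by case: ifP; rewrite ?mul1r ?mul0r.
rewrite ler_wpM2r // ler_pdivrMr // mulrC -natrM ler_nat.
exact: card_tuples_through_adj.
Qed.

(** A Collatz-Wielandt comparison: at an [i] that maximizes [z i / w i], every [z j] is at most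
    [z i / w i * w j]. *)
Lemma weighted_row_bound (e : rel V) (w z : V -> R) (mu mu0 : R) :
  (forall i, 0 < w i) -> (forall i, \sum_(j | e i j) w j <= mu0 * w i) ->
  (exists i, 0 < z i) ->
  (forall i, mu * z i <= \sum_(j | e i j) z j) -> mu <= mu0.
Proof.
move=> w0 wE [i0 zi0] zE.
have [i _ imax] := Order.TotalTheory.arg_maxP (fun i => z i / w i) (erefl : xpredT i0).
have zi : 0 < z i.
  have := imax i0 isT => /(lt_le_trans (divr_gt0 zi0 (w0 i0))).
  by rewrite pmulr_lgt0 // invr_gt0.
have wi := w0 i.
rewrite -(ler_pM2r zi); apply: le_trans (zE i) _.
apply: (@le_trans _ _ (\sum_(j | e i j) z i / w i * w j)).
  by apply: ler_sum => j _; rewrite -ler_pdivrMr //; exact: imax.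
rewrite -mulr_sumr; apply: le_trans (ler_wpM2l _ (wE i)) _.
  by rewrite divr_ge0 // ltW.
by rewrite mulrCA divfK ?gt_eqF // mulrC.
Qed.

(* The weight [deg + alpha] turns the two-step bound into a one-step one. *)
Lemma eigenvalue_le_degree (r : nat) (H : hypergraph V) (l : R[i]) (alpha beta gamma : R) :
  (2 <= r)%N -> uniform r H -> linear_hypergraph H ->
  tensor_eigenvalue (adjacency_tensor R r H) l ->
  0 < alpha -> gamma <= (beta + alpha) * alpha ->
  (forall u, \sum_(v in shadow_nbhd H u) #|shadow_nbhd H v|%:R
     <= beta * #|shadow_nbhd H u|%:R + gamma) ->
  r.-1%:R * cmod l <= beta + alpha.
Proof.
move=> r2 Hu Hl lE a0 ga degE.
have [z [_ z1 zE]] := tensor_eigenvalue_shadow r2 Hu Hl lE.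
apply: (@weighted_row_bound (shadow_adj H) (fun u => #|shadow_nbhd H u|%:R + alpha)) z1 zE.
  by move=> u; rewrite ltr_wpDl.
move=> u; have nbE (F : V -> R) :
    \sum_(v | shadow_adj H u v) F v = \sum_(v in shadow_nbhd H u) F v.
  by apply: eq_bigl => v; rewrite in_shadow_nbhd.
(* The weighted row sum at [u] is at most [(beta + alpha) * d + gamma], with [d] the degree of [u];
   the hypothesis on [gamma] bounds this by [(beta + alpha) * (d + alpha)]. *)
rewrite big_split /= !nbE sumr_const -[alpha *+ _]mulr_natr.
by have := degE u; lra.
Qed.

End Spectral.

(** Two-step paths from [u] are sorted by their end [w]: the return to [u] accounts for [d(u)] of
    them, and each neighbour of [u] for at most [r - 2]. *)
Lemma sum_degree_nbhd (V : finType) (r : nat) (H : hypergraph V) (u : V) :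
  (2 <= r)%N -> uniform r H -> linear_hypergraph H -> berge_free r triangle H ->
  (\sum_(v in shadow_nbhd H u) #|shadow_nbhd H v|
     <= r.-1 * #|shadow_nbhd H u|
        + \sum_(w in ~: (u |: shadow_nbhd H u)) #|shadow_nbhd H u :&: shadow_nbhd H w|)%N.
Proof.
move=> r2 Hu Hl HC.
have -> : (\sum_(v in shadow_nbhd H u) #|shadow_nbhd H v|
    = \sum_w #|shadow_nbhd H u :&: shadow_nbhd H w|)%N.
  under eq_bigr => v _ do rewrite -sum1_card.
  rewrite (exchange_big_dep xpredT) //=; apply: eq_bigr => w _.
  rewrite -sum1_card; apply: eq_bigl => v.
  by rewrite !inE [shadow_adj H w v]shadow_adj_sym.
rewrite (bigID (mem (u |: shadow_nbhd H u))) /= leq_add //; last first.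
  by apply: eq_leq; apply: eq_bigl => w; rewrite !inE.
rewrite big_setU1 /=; last by rewrite inE; apply/negP => /shadow_adjP[]; rewrite eqxx.
rewrite setIid (_ : r.-1 = (r - 2).+1); last by lia.
rewrite mulSn leq_add2l mulnC -sum_nat_const; apply: leq_sum => w; rewrite inE.
exact: card_common_nbhd_adj.
Qed.

(** * Row sums of the square of the shadow graph *)

Lemma card_compl_closed_nbhd (V : finType) (H : hypergraph V) (u : V) :
  (#|~: (u |: shadow_nbhd H u)| + #|shadow_nbhd H u|.+1 = #|V|)%N.
Proof.
rewrite -(cardsC (u |: shadow_nbhd H u)) cardsU1 inE addnC.
by have -> : shadow_adj H u u = false by apply/negP => /shadow_adjP[]; rewrite eqxx.
Qed.

Lemma notin_closed_nbhd_edge (V : finType) (H : hypergraph V) (e : {set V}) (u w : V) :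
  w \in ~: (u |: shadow_nbhd H u) -> e \in H -> u \in e -> w \notin e.
Proof.
rewrite !inE negb_or => /andP[wu uw] eH ue; apply: contra uw => we.
by apply/shadow_adjP; rewrite eq_sym; split=> //; exists e.
Qed.

(** With [t] common neighbours, [u] and [w] would span a complete bipartite graph inside one edge
    and so be adjacent. *)
Lemma card_common_nbhd_nonadj (V : finType) (r t : nat) (H : hypergraph V) (u w : V) :
  (2 <= t)%N -> uniform r H -> linear_hypergraph H ->
  berge_free r (complete_bipartite 2 t) H -> berge_free r triangle H ->
  w \in ~: (u |: shadow_nbhd H u) ->
  (#|shadow_nbhd H u :&: shadow_nbhd H w| <= t.-1)%N.
Proof.
move=> t2 Hu Hl HK HC wu; rewrite leqNgt prednK; last by lia.
apply/negP => /exists_subset_card[B /subsetP Buw Bt].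
have uw : u != w by apply: contraTneq wu => ->; rewrite !inE eqxx.
have AB : {in [set u; w] & B, forall a b, shadow_adj H a b}.
  move=> a b + /Buw; rewrite !inE => /orP[]/eqP-> /andP[ub wb] //.
have [e eH] := shadow_Kst_in_edge Hu Hl HC (leqnn 2) t2 HK
  (etrans (cards2 u w) (congr1 _ (congr1 _ uw))) Bt AB.
rewrite !subUset !sub1set => /andP[/andP[ue we] _].
by have := notin_closed_nbhd_edge wu eH ue; rewrite we.
Qed.

(** Since [u] is itself a common neighbour of [S], already [t - 1] further ones complete a
    [K_{s,t}]; the edge containing it would make them adjacent to [u]. *)
Lemma card_nonadj_common_nbhd (V : finType) (r s t : nat) (H : hypergraph V) (u : V)
    (S : {set V}) :
  (2 <= s)%N -> (2 <= t)%N -> uniform r H -> linear_hypergraph H ->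
  berge_free r (complete_bipartite s t) H -> berge_free r triangle H ->
  S \subset shadow_nbhd H u -> #|S| = s ->
  (#|[set w in ~: (u |: shadow_nbhd H u) | S \subset shadow_nbhd H w]| <= t - 2)%N.
Proof.
move=> s2 t2 Hu Hl HK HC Su Ss; rewrite leqNgt; apply/negP.
rewrite (_ : (t - 2).+1 = t.-1); last by lia.
move=> /exists_subset_card[B /subsetP BW Bt].
have uB : u \notin B by apply/negP => /BW; rewrite !inE eqxx.
have Bt' : #|u |: B| = t by rewrite cardsU1 uB Bt; lia.
have SB : {in S & u |: B, forall a b, shadow_adj H a b}.
  move=> a b aS; rewrite shadow_adj_sym in_setU1 => /predU1P[->|/BW].
    by rewrite -in_shadow_nbhd (subsetP Su).
  by rewrite inE => /andP[_ /subsetP/(_ a aS)]; rewrite in_shadow_nbhd.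
have [e eH] := shadow_Kst_in_edge Hu Hl HC s2 t2 HK Ss Bt' SB.
rewrite !subUset sub1set => /and3P[_ ue /subsetP Be].
have [b bB] : exists b, b \in B by apply/card_gt0P; rewrite Bt; lia.
have := BW b bB; rewrite inE => /andP[bu _].
by have := notin_closed_nbhd_edge bu eH ue; rewrite Be.
Qed.

(** * The two bounds on the spectral radius *)

Lemma spectral_radius_K2t (R : realType) (V : finType) (r t : nat) (H : hypergraph V) :
  (2 <= r)%N -> (2 <= t)%N -> (0 < #|V|)%N ->
  uniform r H -> linear_hypergraph H ->
  berge_free r (complete_bipartite 2 t) H -> berge_free r triangle H ->
  spectral_radius R r H <=
    (Num.sqrt (4 * (t%:R - 1) * (#|V|%:R - 1) + (r%:R - t%:R) ^+ 2)
       + r%:R - t%:R) / (2 * (r%:R - 1)).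
Proof.
move=> r2 t2 n0 Hu Hl HK HC.
set g : R := (t%:R - 1) * (#|V|%:R - 1).
set Delta := 4 * _ * _ + _; have DeltaE : Delta = 4 * g + (r%:R - t%:R) ^+ 2.
  by rewrite /Delta /g mulrA.
have r1 : 0 < r%:R - 1 :> R by rewrite subr_gt0 ltr1n.
have g0 : 0 <= g by rewrite mulr_ge0 // subr_ge0 ler1n // ltnW.
have D0 : 0 <= Delta by rewrite DeltaE addr_ge0 ?sqr_ge0 // mulr_ge0.
have sD0 := sqrtr_ge0 Delta; have sDE := sqr_sqrtr D0.
have abs_le : `|r%:R - t%:R : R| <= Num.sqrt Delta.
  by rewrite -sqrtr_sqr ler_wsqrtr // DeltaE; lra.
have := abs_le; rewrite ler_norml => /andP[le1 le2].
have mu0 : 0 <= (Num.sqrt Delta + r%:R - t%:R) / 2 by lra.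
have mur : r.-1%:R = r%:R - 1 :> R by rewrite -subn1 natrB // ltnW.
apply: spectral_radius_le => [|l lE].
  by rewrite divr_ge0 ?mulr_ge0 ?(ltW r1) //; lra.
rewrite invfM mulrA ler_pdivlMr // mulrC -mur.
(* For a single vertex [g] vanishes and the general choice of [alpha] may be 0. All degrees are then
   0, so [beta = -1] and [alpha = 1] serve. *)
have [n1|n1] := leqP #|V| 1.
  apply: le_trans mu0; rewrite -[leRHS](addNr 1).
  apply: (@eigenvalue_le_degree R V r H l 1 (-1) 0) => //; first by lra.
  move=> u; have := card_compl_closed_nbhd H u => nE.
  have d0 : #|shadow_nbhd H u| = 0%N by lia.
  by rewrite (cards0_eq d0) big_set0 cards0; lra.
have gp : 0 < g by rewrite mulr_gt0 // subr_gt0 ltr1n.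
have lt2 : `|r%:R - t%:R : R| < Num.sqrt Delta.
  have Dp : 0 < Delta by rewrite DeltaE; have := sqr_ge0 (r%:R - t%:R : R); lra.
  by rewrite -sqrtr_sqr ltr_sqrt // DeltaE; lra.
have := lt2; rewrite ltr_norml => /andP[_ lt3].
have -> : (Num.sqrt Delta + r%:R - t%:R) / 2
   = (r%:R - t%:R) + (Num.sqrt Delta - (r%:R - t%:R)) / 2 by field.
(* Here [beta = r - t], and [alpha] is the positive root of [(beta + alpha) * alpha = g]. *)
apply: (@eigenvalue_le_degree R V r H l _ _ g) => //; first by lra.
  have -> : (r%:R - t%:R + (Num.sqrt Delta - (r%:R - t%:R)) / 2)
       * ((Num.sqrt Delta - (r%:R - t%:R)) / 2)
     = (Num.sqrt Delta ^+ 2 - (r%:R - t%:R) ^+ 2) / 4 :> R by field.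
  by rewrite sDE DeltaE; lra.
move=> u; rewrite -natr_sum.
set d := #|shadow_nbhd H u|; set W := ~: (u |: shadow_nbhd H u).
have degE : (\sum_(v in shadow_nbhd H u) #|shadow_nbhd H v| <= r.-1 * d + #|W| * t.-1)%N.
  apply: leq_trans (sum_degree_nbhd u r2 Hu Hl HC) _; rewrite leq_add2l.
  rewrite -sum_nat_const; apply: leq_sum => w; exact: card_common_nbhd_nonadj t2 Hu Hl HK HC.
have WE : #|W|%:R = #|V|%:R - 1 - d%:R :> R.
  by rewrite -(card_compl_closed_nbhd H u) -/W -/d natrD -natr1; ring.
move: degE; rewrite -(ler_nat R) natrD !natrM mur WE => degE.
have tE : t.-1%:R = t%:R - 1 :> R by rewrite -subn1 natrB // ltnW.
by rewrite tE in degE; apply: le_trans degE _; rewrite /g; lra.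
Qed.

Lemma exprn_powR_inv (R : realType) (x : R) (s j : nat) : (0 < s)%N -> 0 <= x ->
  (x `^ (1 / s%:R)) ^+ j = x `^ (j%:R / s%:R).
Proof.
by move=> s0 x0; rewrite -powR_mulrn ?powR_ge0 // -powRrM mulrC mul1r.
Qed.

Lemma spectral_radius_Kst (R : realType) (V : finType) (r s t : nat) (H : hypergraph V) :
  (2 <= r)%N -> (3 <= s)%N -> (s <= t)%N -> (0 < #|V|)%N ->
  uniform r H -> linear_hypergraph H ->
  berge_free r (complete_bipartite s t) H -> berge_free r triangle H ->
  spectral_radius R r H <=
    (t%:R - s%:R + 1) `^ (1 / s%:R) / (r%:R - 1) * #|V|%:R `^ (1 - 1 / s%:R)
    + (s%:R - 1) / (r%:R - 1) * #|V|%:R `^ (1 - 2 / s%:R)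
    + (s%:R - 2).
Proof.
move=> r2 s3 st n0 Hu Hl HK HC.
have s0 : (0 < s)%N by lia.
have sR : s%:R != 0 :> R by rewrite pnatr_eq0 -lt0n.
pose q : R := (t - s).+1%:R `^ (1 / s%:R).
pose N : R := #|V|%:R `^ (1 / s%:R).
have root_ge1 (c : nat) : (0 < c)%N -> 1 <= c%:R `^ (1 / s%:R) :> R.
  move=> c0; rewrite -[leLHS](congr1 (fun f => f (1 / s%:R)) (powR1 R)).
  by rewrite ge0_ler_powR ?nnegrE ?ler1n // divr_ge0.
have q1 : 1 <= q by exact: root_ge1.
have N1 : 1 <= N by exact: root_ge1.
have rootX (c : nat) : (c%:R `^ (1 / s%:R)) ^+ s = c%:R :> R.
  by rewrite exprn_powR_inv // divff // powRr1.
have -> : t%:R - s%:R + 1 = (t - s).+1%:R :> R by rewrite -natr1 natrB.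
have -> : #|V|%:R `^ (1 - 1 / s%:R) = N ^+ s.-1 :> R.
  rewrite exprn_powR_inv //; congr (_ `^ _).
  by rewrite -subn1 natrB // mulrBl divff.
have -> : #|V|%:R `^ (1 - 2 / s%:R) = N ^+ (s - 2) :> R.
  rewrite exprn_powR_inv //; congr (_ `^ _).
  by rewrite natrB ?mulrBl ?divff // ltnW.
rewrite -/q.
have r1 : 0 < r%:R - 1 :> R by rewrite subr_gt0 ltr1n.
have mur : r.-1%:R = r%:R - 1 :> R by rewrite -subn1 natrB // ltnW.
have N0 k : 0 <= N ^+ k by rewrite exprn_ge0 // (le_trans _ N1).
have q0 : 0 <= q := le_trans ler01 q1.
have sge3 : 3 <= s%:R :> R by rewrite (ler_nat R 3 s).
have rge2 : 2 <= r%:R :> R by rewrite (ler_nat R 2 r).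
apply: spectral_radius_le => [|l lE].
  have s1 : 0 <= s%:R - 1 :> R by lra.
  have s2 : 0 <= s%:R - 2 :> R by lra.
  by apply: addr_ge0 => //; apply: addr_ge0; rewrite mulr_ge0 // divr_ge0 // ltW.
rewrite -(ler_pM2l r1) -mur.
(* The Zarankiewicz bound is used with [m = s - 1], [c = t - s + 1] and [k = s - 3], so that
   [c + k = t - 2]. Its constant term is [N ^+ s.-1 * alpha], and [N ^+ s.-1 <= beta] because
   [q >= 1]. *)
pose alpha : R := (s%:R - 1) * N ^+ (s - 2).
pose beta : R := (r%:R - 1) + (q * N ^+ s.-1 + (s - 3)%:R).
have a0 : 0 < alpha.
  by rewrite mulr_gt0 ?exprn_gt0 ?(lt_le_trans _ N1) //; lra.
have s3E : (s - 3)%:R = s%:R - 3 :> R by rewrite natrB.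
have := @eigenvalue_le_degree R V r H l alpha beta ((s%:R - 1) * N ^+ (s + (s - 3)))
  r2 Hu Hl lE a0.
move=> bound; apply: le_trans (bound _ _) _.
- have -> : (s%:R - 1) * N ^+ (s + (s - 3)) = N ^+ s.-1 * alpha.
    by rewrite /alpha mulrCA -exprD; congr (_ * _ ^+ _); lia.
  rewrite ler_wpM2r ?(ltW a0) //.
  have : N ^+ s.-1 <= q * N ^+ s.-1 by rewrite ler_peMl.
  by rewrite /beta s3E; lra.
- move=> u; rewrite -natr_sum.
  have := sum_degree_nbhd u r2 Hu Hl HC; rewrite -(ler_nat R).
  move=> /le_trans; apply; rewrite natrD natrM mur natr_sum.
  rewrite /beta [(r%:R - 1 + _) * _]mulrDl -[leRHS]addrA lerD2l.
  have few (S : {set V}) : S \subset shadow_nbhd H u -> #|S| = s.-1.+1 ->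
      (#|[set w in ~: (u |: shadow_nbhd H u) | S \subset shadow_nbhd H w]|
         <= (t - s).+1 + (s - 3))%N.
    rewrite prednK // => Su Ss.
    have := @card_nonadj_common_nbhd V r s t H u S.
    by rewrite (_ : (t - s).+1 + (s - 3) = t - 2)%N; [apply=> //; lia|lia].
  have WN : #|~: (u |: shadow_nbhd H u)|%:R <= N ^+ s.-1.+1.
    by rewrite prednK // rootX ler_nat max_card.
  have qs : q ^+ s.-1.+1 = (t - s).+1%:R by rewrite prednK // rootX.
  have := zarankiewicz_sum q1 N1 qs WN few; rewrite prednK //.
  by rewrite (_ : s.-1%:R = s%:R - 1) // -subn1 natrB.
- rewrite /alpha /beta s3E mur; set X := N ^+ s.-1; set Y := N ^+ (s - 2).
  have -> : (r%:R - 1) * (q / (r%:R - 1) * X + (s%:R - 1) / (r%:R - 1) * Y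
                          + (s%:R - 2))
      = q * X + (s%:R - 1) * Y + (s%:R - 2) * (r%:R - 1).
    by field; rewrite gt_eqF.
  (* This product is exactly the slack between [beta + alpha] and the claimed bound times
     [r - 1]. *)
  have : 0 <= (s%:R - 3) * (r%:R - 2) :> R by rewrite mulr_ge0 // subr_ge0.
  by lra.
Qed.

Theorem theorem3p8 (R : realType) (V : finType) (n r s t : nat)
    (H : hypergraph V)
    (r_ge2 : (2 <= r)%N) (s_ge2 : (2 <= s)%N) (s_le_t : (s <= t)%N)
    (n_gt0 : (0 < n)%N) (card_V : #|V| = n)
    (H_uniform : uniform r H) (H_linear : linear_hypergraph H)
    (H_Kst_free : berge_free r (complete_bipartite s t) H)
    (H_C3_free : berge_free r triangle H) :
  (s = 2%N ->
    spectral_radius R r H <=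
      (Num.sqrt (4 * (t%:R - 1) * (n%:R - 1) + (r%:R - t%:R) ^+ 2)
         + r%:R - t%:R) / (2 * (r%:R - 1))) /\
  ((3 <= s)%N ->
    spectral_radius R r H <=
      (t%:R - s%:R + 1) `^ (1 / s%:R) / (r%:R - 1) * n%:R `^ (1 - 1 / s%:R)
      + (s%:R - 1) / (r%:R - 1) * n%:R `^ (1 - 2 / s%:R)
      + (s%:R - 2)).
Proof.
rewrite -card_V in n_gt0 *; split=> [s2|s3].
  by rewrite s2 in s_le_t H_Kst_free; apply: spectral_radius_K2t.
exact: spectral_radius_Kst.
Qed.
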